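(* Let $q=n-k$, write $\mathbb R^n=\mathbb R^k\times\mathbb R^q$, and let $B\colon\mathbb R^q\to\mathrm{Hom}(\mathbb R^k,\mathbb R^q)$ be continuous. For $y\in\mathbb R^q$ let $P_y=\{(t,\,y+B(y)t): t\in\mathbb R^k\}$ (oriented via $\mathbb R^k$), let $A(y)\in\mathrm{Hom}(\mathbb R^{k+1},\mathbb R^q)$ be $A(y)(t,\lambda)=B(y)t+\lambda y$, and let $d(y)$ be the distance from the origin of $\mathbb R^n$ to $P_y$. Then the planes $P_y$, $y\in\mathbb R^q$, are the fibers of a skew fibration of $\mathbb R^n$ if and only if (i) for every pair of distinct points $x,y\in\mathbb R^q$, $\mathrm{Ker}(A(x)-A(y))=0$, and (ii) whenever $x_n$ is a sequence in $\mathbb R^q$ with no accumulation points, $d(x_n)\to\infty$. Conversely, every skew fibration of $\mathbb R^n$ by oriented affine $k$-planes which admits an affine $q$-plane transverse to all fibers can be described in this way by such a $B$, after an isometric change of coordinates identifying that transverse plane with $\{0\}\times\mathbb R^q$.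
   Context: A fibration of $\mathbb R^n$ by oriented affine $k$-planes is a family of pairwise disjoint oriented affine $k$-planes covering $\mathbb R^n$ such that the map sending a point to the fiber through it is continuous. It is skew if no two distinct fibers contain parallel lines. Two affine subspaces are transverse if their parallel linear subspaces meet only in $0$. *)

(* Defs.v *)
From HB Require Import structures.
From mathcomp Require Import all_boot all_order all_algebra.
From mathcomp Require Import all_classical all_reals all_analysis.
Set Implicit Arguments. Unset Strict Implicit. Unset Printing Implicit Defensive.
Import Order.TTheory GRing.Theory Num.Theory.
Import numFieldNormedType.Exports.
Local Open Scope ring_scope.
Local Open Scope classical_set_scope.

(* Points of R^n are row vectors 'rV[R]_n.
   An oriented affine k-plane in R^n is represented by a base point and a
   k x n matrix whose rows form an (ordered, hence oriented) basis of the
   direction space; the plane is { pt + t *m dir | t in R^k }. *)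
Record oplane (R : realType) (n k : nat) :=
  OPlane { op_pt : 'rV[R]_n ; op_dir : 'M[R]_(k, n) }.

Section Defs.
Variable R : realType.

Definition op_pts n k (P : oplane R n k) : set 'rV[R]_n :=
  [set x | exists t : 'rV[R]_k, x = op_pt P + t *m op_dir P].

Definition op_eq n k (P Q : oplane R n k) : Prop :=
  op_pts P = op_pts Q /\
  exists G : 'M[R]_k, 0 < \det G /\ op_dir Q = G *m op_dir P.

(* Fib is the family of fibers (given by representatives). *)
Definition is_fibration n k (Fib : set (oplane R n k)) : Prop :=
  [/\
      forall P, Fib P -> row_free (op_dir P),
      forall x, exists2 P, Fib P & op_pts P x,
      forall P Q, Fib P -> Fib Q ->
        (exists x, op_pts P x /\ op_pts Q x) -> op_eq P Q &
      (* continuity of x |-> fiber through x, into the space of oriented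
         affine k-planes (written via local continuous frames) *)
      forall x0 : 'rV[R]_n, exists U : set 'rV[R]_n,
        [/\ open U, U x0 &
          exists (p : 'rV[R]_n -> 'rV[R]_n) (M : 'rV[R]_n -> 'M[R]_(k, n)),
            (forall x, U x -> {for x, continuous p} /\ {for x, continuous M}) /\
            (forall x, U x -> exists2 P, Fib P &
                 op_pts P x /\ op_eq P (OPlane (p x) (M x)))]].

Definition skew_family n k (Fib : set (oplane R n k)) : Prop :=
  forall P Q, Fib P -> Fib Q -> ~ op_eq P Q ->
    forall v : 'rV[R]_n, (v <= op_dir P)%MS -> (v <= op_dir Q)%MS -> v = 0.

Definition transverse_all n k m (Fib : set (oplane R n k)) (T : oplane R n m) :=
  forall P, Fib P ->
    forall v : 'rV[R]_n, (v <= op_dir P)%MS -> (v <= op_dir T)%MS -> v = 0.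

Definition Py k q (B : 'rV[R]_q -> 'M[R]_(k, q)) (y : 'rV[R]_q)
  : oplane R (k + q) k :=
  OPlane (row_mx 0 y) (row_mx 1%:M (B y)).

(* A(y)(t, lambda) = B(y) t + lambda y, as a matrix acting on row vectors *)
Definition Amat k q (B : 'rV[R]_q -> 'M[R]_(k, q)) (y : 'rV[R]_q)
  : 'M[R]_(k + 1, q) := col_mx (B y) y.

Definition eucl_norm n (v : 'rV[R]_n) : R := Num.sqrt (\sum_i v 0 i ^+ 2).

Definition dist0 k q (B : 'rV[R]_q -> 'M[R]_(k, q)) (y : 'rV[R]_q) : R :=
  inf [set eucl_norm p | p in op_pts (Py B y)].

Definition no_accum q (u : nat -> 'rV[R]_q) : Prop :=
  forall z : 'rV[R]_q, exists2 U, nbhs z U & \forall m \near \oo, ~ U (u m).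

Definition op_img n k (Q : 'M[R]_n) (c : 'rV[R]_n) (P : oplane R n k) :=
  OPlane (op_pt P *m Q + c) (op_dir P *m Q).

End Defs.

(* Main.v *)
(* Disjointness of the planes [P_y] is the injectivity of the maps
   [y |-> y + B(y) t], and skewness is the injectivity of [y |-> B(y) t] for
   [t <> 0]; together they are (i).  In a fibration the base point [y] of the
   fiber through [x] is a continuous function of [x], so it sends bounded sets
   into compact ones, which is (ii).  Conversely (i) and (ii) make
   [y |-> y + B(y) t] injective and proper; solving [y = z - B(y) t] is a fixed
   point problem whose a priori bound for [y = s (z - B(y) t)], [0 <= s <= 1],
   comes from (ii), since [s (t, z)] lies on [P_y].  The fixed point theorem is
   reduced to Poincare-Miranda, whose discrete form says that the mod 2 cup
   product [db_1 u ... u db_n] of the coboundaries of [n] sign bits has integral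
   [1] over the cube, by Stokes.  For the last part, an orthonormal frame adapted
   to the transverse plane turns every fiber into a graph over [R^k]; the sign of
   the orientation is constant because [R^n] is connected, and a reflection makes
   it positive. *)
Require Import Defs.
From HB Require Import structures.
From mathcomp Require Import all_boot all_order all_algebra.
From mathcomp Require Import all_classical all_reals all_analysis.
From mathcomp Require Import ring lra.
Import Order.TTheory GRing.Theory Num.Theory.
Import numFieldNormedType.Exports.
Local Open Scope ring_scope.
Local Open Scope classical_set_scope.

(** * A mod 2 counting lemma on cubical grids *)

Section CubicalCup.
Set Implicit Arguments. Unset Strict Implicit.
Variables (I : finType) (p : nat) (b : I -> (I -> nat) -> 'F_2).
Implicit Types (i j : I) (s : seq I) (S : {set I}) (v w : I -> nat).

Definition upd v i x : I -> nat := fun j => if j == i then x else v j.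
Definition step v i := upd v i (v i).+1.

Lemma updC v i j x y : i != j -> upd (upd v i x) j y = upd (upd v j y) i x.
Proof.
move=> ij; apply/funext => l; rewrite /upd.
by have [->|//] := eqVneq l j; rewrite eq_sym (negPf ij).
Qed.

Lemma stepC v i j : step (step v i) j = step (step v j) i.
Proof.
have [->//|ij] := eqVneq i j.
have ji : j != i by rewrite eq_sym.
rewrite /step updC // /upd (negPf ij) (negPf ji) //.
Qed.

Lemma addrr_F2 (x : 'F_2) : x + x = 0.
Proof. exact/addrr_pchar2/pchar_Fp. Qed.

(** The terms of [(i, j)] and [(j, i)] are equal and cancel in characteristic 2; the order by
    [enum_rank] selects one pair out of each two. *)
Lemma sum_sym_pairs S (G : I -> I -> 'F_2) : (forall i j, G i j = G j i) ->
  \sum_(i in S) \sum_(j in S :\ i) G i j = 0.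
Proof.
move=> Gsym.
pose r i j := (enum_rank i < enum_rank j)%N.
have rE i j : (j != i) && ~~ r i j = r j i.
  rewrite /r -leqNgt ltn_neqAle; congr (_ && _).
  by rewrite -(inj_eq enum_rank_inj).
have neqr i j : r i j -> j != i.
  by apply: contraTneq => ->; rewrite /r ltnn.
under eq_bigr => i _ do rewrite (bigID (r i)) /=.
rewrite big_split /= [X in _ + X](exchange_big_dep (mem S)) /=; last first.
  by move=> i j _; rewrite !inE -andbA => /and3P[].
rewrite -[RHS](addrr_F2 (\sum_(i in S) \sum_(j in S | r i j) G i j)).
congr (_ + _); apply: eq_bigr => i iS.
  apply: eq_bigl => j; rewrite !inE andbC; case: (boolP (r i j)) => [/neqr ->|] /=.
    by rewrite andbT.
  by rewrite andbF.
apply: eq_big => [j|j _]; last exact: Gsym.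
by rewrite !inE (iS : i \in S) andbT -(rE j i).
Qed.

(** The cup product of the coboundaries [db_i], [i] in [s], on the cube with lowest vertex [v] and
    directions [S]: a sum over monotone edge paths, the successive edges being fed to the successive
    factors. *)
Fixpoint cup s S v : 'F_2 :=
  if s is i :: s' then
    \sum_(j in S) (b i (step v j) + b i v) * cup s' (S :\ j) (step v j)
  else 1.

(* Each cochain [cup s] is closed: it is a product of coboundaries. *)
Lemma cup_closed s S v : #|S| = (size s).+1 ->
  \sum_(j in S) cup s (S :\ j) (step v j) = \sum_(j in S) cup s (S :\ j) v.
Proof.
elim: s S v => [|l s IH] S v cS /=; first by [].
have cS1 i : i \in S -> #|S :\ i| = (size s).+1.
  by move=> iS; apply/eqP; rewrite -eqSS -cS (cardsD1 i S) iS.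
have S21 i j : S :\ i :\ j = S :\ j :\ i.
  by apply/setP => x; rewrite !inE andbCA.
have swap (G : I -> I -> 'F_2) : \sum_(i in S) \sum_(j in S :\ i) G i j =
    \sum_(i in S) \sum_(j in S :\ i) G j i.
  rewrite (exchange_big_dep (mem S)) /=; last by move=> i j _; rewrite !inE => /andP[].
  apply: eq_bigr => i iS; apply: eq_bigl => j.
  by rewrite !inE iS andbT eq_sym andbC.
(* On the left, the terms carrying [b l] at the doubly stepped vertex are symmetric in the two
   directions and cancel. *)
under eq_bigr do under eq_bigr do rewrite mulrDl.
under eq_bigr do rewrite big_split /=.
rewrite big_split /= sum_sym_pairs; last by move=> i j; rewrite stepC S21.
rewrite add0r.
under [RHS]eq_bigr do under eq_bigr do rewrite mulrDl.
under [RHS]eq_bigr do rewrite big_split /=.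
rewrite big_split /= [X in _ = X + _]swap.
(* By induction the inner sum may be taken at [v], where it becomes symmetric. *)
have -> : \sum_(i in S) \sum_(j in S :\ i)
    b l v * cup s (S :\ i :\ j) (step v j) = 0.
  under eq_bigr => i iS do rewrite -mulr_sumr IH ?cS1 // mulr_sumr.
  by apply: sum_sym_pairs => i j; rewrite S21.
rewrite addr0; apply: eq_bigr => i iS.
rewrite -mulr_sumr IH ?cS1 // mulr_sumr.
by apply: eq_bigr => j _; rewrite S21.
Qed.

(** Integration over the cells of the grid with [p] cells per direction in [s]: each cell is indexed
    by its lowest vertex, hence the strict bound by [p]. Coordinates outside [s] are read from
    [v]. *)
Fixpoint boxsum s (F : (I -> nat) -> 'F_2) v : 'F_2 :=
  if s is i :: s' then \sum_(x < p) boxsum s' F (upd v i x) else F v.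

Lemma eq_boxsum s F G v : F =1 G -> boxsum s F v = boxsum s G v.
Proof. by move=> FG; elim: s v => //= i s IH v; apply: eq_bigr. Qed.

Lemma boxsum0 s v : boxsum s (fun=> 0) v = 0.
Proof. by elim: s v => //= i s IH v; apply: big1. Qed.

Lemma boxsum_sum (J : finType) (P : pred J) s (F : J -> (I -> nat) -> 'F_2) v :
  boxsum s (fun w => \sum_(i | P i) F i w) v = \sum_(i | P i) boxsum s (F i) v.
Proof.
by elim: s v => //= i s IH v; rewrite exchange_big; apply: eq_bigr.
Qed.

Lemma boxsum_upd s F v i x : i \notin s ->
  boxsum s (fun w => F (upd w i x)) v = boxsum s F (upd v i x).
Proof.
elim: s v => //= j s IH v; rewrite inE negb_or => /andP[ij si].
by apply: eq_bigr => y _; rewrite IH // updC // eq_sym.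
Qed.

Lemma boxsum_rem s F v i : i \in s ->
  boxsum s F v = boxsum (i :: rem i s) F v.
Proof.
elim: s v => //= j s IH v; rewrite inE.
have [->//|ij] := eqVneq i j; rewrite /= => si.
rewrite exchange_big; apply: eq_bigr => x _.
by rewrite IH //=; apply: eq_bigr => y _; rewrite updC // eq_sym.
Qed.

Lemma telescope_F2 (f : nat -> 'F_2) n :
  \sum_(x < n) (f x.+1 + f x) = f n + f 0%N.
Proof.
elim: n => [|n IH]; first by rewrite big_ord0 addrr_F2.
by rewrite big_ord_recr /= IH addrC -addrA (addrA (f n)) addrr_F2 add0r.
Qed.

(** Sums are differences over [F_2], so the summation along direction [i] telescopes to the two
    opposite faces. *)
Lemma boxsum_step s F v i : i \in s -> uniq s ->
  boxsum s (fun w => F (step w i) + F w) v =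
  boxsum (rem i s) (fun w => F (upd w i p) + F (upd w i 0%N)) v.
Proof.
move=> si us; rewrite (boxsum_rem _ _ si) /=.
have inn : i \notin rem i s by rewrite mem_rem_uniq // inE eqxx.
under eq_bigr do rewrite -boxsum_upd //.
rewrite -boxsum_sum; apply: eq_boxsum => w.
rewrite -(telescope_F2 (fun x => F (upd w i x))); apply: eq_bigr => x _.
by congr (F _ + _); apply/funext => j; rewrite /step /upd eqxx; case: eqP.
Qed.

Hypotheses (b0 : forall i v, v i = 0%N -> b i v = 0)
           (b1 : forall i v, v i = p -> b i v = 1).

(** Every path stays in the face, where [b i] is constant, so the factor [db_i] vanishes on each of
    its edges. *)
Lemma cup_face s S v i : i \in s -> i \notin S -> v i = 0%N \/ v i = p ->
  cup s S v = 0.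
Proof.
elim: s S v => // j s IH S v si iS vi /=; apply: big1 => l lS.
have li : l != i by apply: contraNneq iS => <-.
have stepi : step v l i = v i by rewrite /step /upd eq_sym (negPf li).
move: si; rewrite inE => /predU1P[<-|si]; last first.
  by rewrite (IH _ _ si) ?mulr0 ?stepi // !inE negb_and iS orbT.
by case: vi => vi; [rewrite !b0|rewrite !b1]; rewrite ?stepi // addrr_F2 mul0r.
Qed.

(* Stokes: only the face where the first coordinate equals [p] contributes. *)
Lemma boxsum_cup s v : uniq s -> boxsum s (cup s [set i in s]) v = 1.
Proof.
elim: s v => //= i s IH v /andP[si us].
pose S := [set j in i :: s].
have cS j : j \in S -> #|S :\ j| = size s.
  move=> jS; apply/eqP; rewrite -eqSS.
  have -> : (size s).+1 = #|S| by rewrite cardsE (card_uniqP _) //= si us.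
  by rewrite (cardsD1 j S) jS.
have SE : S :\ i = [set j in s].
  by apply/setP => j; rewrite !inE; case: eqVneq => // ->; rewrite (negPf si).
rewrite -[LHS]/(boxsum (i :: s) (fun w => \sum_(j in S)
  (b i (step w j) + b i w) * cup s (S :\ j) (step w j)) v).
(* Since [cup s] is closed, the integrand is the coboundary of [b i * cup s]: a sum of differences,
   one for each direction in [S]. *)
rewrite (@eq_boxsum _ _ (fun w => \sum_(j in S)
   (b i (step w j) * cup s (S :\ j) (step w j) + b i w * cup s (S :\ j) w))).
  2: { move=> w; under eq_bigr do rewrite mulrDl.
    rewrite !big_split /= -!mulr_sumr cup_closed //.
    by rewrite cardsE (card_uniqP _) //= si us. }
have [t tE] : exists t, t = i :: s by exists (i :: s).
have [ut it] : uniq t /\ i \in t by rewrite tE /= si us inE eqxx.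
have tS : t =i S by move=> j; rewrite tE !inE.
rewrite -tE boxsum_sum (bigD1 i) -?tS //= big1 ?addr0; last first.
  move=> j /andP[jS ji].
  have js : j \in s by move: jS; rewrite !inE (negPf ji).
  rewrite (boxsum_step (fun w => b i w * cup s (S :\ j) w)) ?tS //.
  rewrite (@eq_boxsum _ _ (fun=> 0)) ?boxsum0 // => w.
  rewrite !(@cup_face _ _ _ j) ?mulr0 ?addr0 //.
  - by rewrite !inE eqxx.
  - by left; rewrite /upd eqxx.
  - by rewrite !inE eqxx.
  - by right; rewrite /upd eqxx.
rewrite (boxsum_step (fun w => b i w * cup s (S :\ i) w)) // tE /= eqxx.
rewrite (@eq_boxsum _ _ (fun w => cup s [set j in s] (upd w i p))).
  by rewrite boxsum_upd // IH.
by move=> w; rewrite b1 ?b0 /upd ?eqxx // mul1r mul0r addr0 SE.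
Qed.

Lemma boxsum_neq0 s F v : boxsum s F v != 0 ->
  exists w, [/\ forall i, i \in s -> (w i < p)%N,
    forall i, i \notin s -> w i = v i & F w != 0].
Proof.
elim: s v => [|i s IH] v /=; first by exists v.
move=> sn0; have [x /IH[w [ws wv Fw]]] :
    exists x : 'I_p, boxsum s F (upd v i x) != 0.
  apply/not_existsP => H; move/eqP: sn0; apply; apply: big1 => x _.
  by apply/eqP/negPn/negP/H.
have wE j : j \notin s -> w j = upd v i x j by move=> /wv.
exists w; split=> // j; rewrite inE.
  have [js _|js] := boolP (j \in s); first exact: ws.
  by rewrite orbF => /eqP ji; rewrite wE // /upd ji eqxx.
by rewrite negb_or => /andP[/negPf ji /wE->]; rewrite /upd ji.
Qed.

Definition in_cube v w := forall i, (v i <= w i <= (v i).+1)%N.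

(** Some path has a nonzero product, so each [b i] changes along an edge of that path. *)
Lemma cup_neq0 s S v : cup s S v != 0 -> forall i, i \in s ->
  exists w1 w2, [/\ forall j, (v j <= w1 j <= v j + (j \in S))%N,
    forall j, (v j <= w2 j <= v j + (j \in S))%N, b i w1 = 0 & b i w2 = 1].
Proof.
elim: s S v => // l s IH S v /= cn0 i si.
have [j jS /[!mulf_eq0] /norP[bj cj]] : exists2 j, j \in S &
    (b l (step v j) + b l v) * cup s (S :\ j) (step v j) != 0.
  apply/not_exists2P => H; move/eqP: cn0; apply; apply: big1 => j jS.
  by have [//|/negP/negPn/eqP] := H j.
have stepb x : (v x <= step v j x <= v x + (x \in S))%N.
  rewrite /step /upd; have [->|] := eqVneq x j; last by rewrite leqnn leq_addr.
  by rewrite jS addn1 leqnSn leqnn.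
have vb x : (v x <= v x <= v x + (x \in S))%N by rewrite leqnn leq_addr.
move: si; rewrite inE => /predU1P[->|si]; last first.
  have sub w : (forall x, (step v j x <= w x <= step v j x + (x \in S :\ j))%N) ->
      forall x, (v x <= w x <= v x + (x \in S))%N.
    move=> H x; have /andP[h1 h2] := H x; have /andP[h3 _] := stepb x.
    rewrite (leq_trans h3 h1) /= (leq_trans h2) //.
    by rewrite /step /upd !inE; case: eqVneq => [->|] //=; rewrite jS addn1 addn0.
  by have [w1 [w2 [h1 h2 e1 e2]]] := IH _ _ cj _ si;
    exists w1, w2; split=> //; exact: sub.
have F2P (x : 'F_2) : x = 0 \/ x = 1.
  by case: x => [[|[|//]] h]; [left|right]; apply/val_inj.
case: (F2P (b l v)) (F2P (b l (step v j))) bj => e1 [] e2; rewrite e1 e2.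
- by rewrite addr0 eqxx.
- by exists v, (step v j).
- by exists (step v j), v.
- by rewrite addrr_F2 eqxx.
Qed.

(** Discrete Poincare-Miranda: the full cup product has integral [1], hence is nonzero on some
    cell. *)
Lemma cube_changing_bits : exists v, (forall i, (v i < p)%N) /\
  forall i, exists w1 w2, [/\ in_cube v w1, in_cube v w2, b i w1 = 0 & b i w2 = 1].
Proof.
have := boxsum_cup (fun=> 0%N) (enum_uniq I).
move=> /eqP; rewrite -[_ == 1]negbK => /negPn H.
have /boxsum_neq0[v [vp _ cn0]] :
    boxsum (enum I) (cup (enum I) [set i in enum I]) (fun=> 0%N) != 0.
  by apply: contraTneq H => ->; rewrite eq_sym oner_eq0.
exists v; split=> [i|i]; first by rewrite vp // mem_enum.
have [w1 [w2 [h1 h2 e1 e2]]] := cup_neq0 cn0 (mem_enum I i).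
exists w1, w2; split=> // j.
  by have := h1 j; rewrite inE mem_enum addn1.
by have := h2 j; rewrite inE mem_enum addn1.
Qed.

End CubicalCup.

(** * Limits of matrix-valued functions *)

Section MatrixLimits.
Set Implicit Arguments. Unset Strict Implicit.
Context {R : realType} {T : Type} {F : set_system T} {FF : Filter F}.

Lemma cvg_mxP m n (f : T -> 'M[R]_(m, n)) (A : 'M[R]_(m, n)) :
  f @ F --> A <-> forall i j, (f x i j @[x --> F] --> A i j).
Proof.
split=> [fA i j|fA].
  apply: (cvg_comp f (fun M : 'M[R]_(m, n) => M i j)) fA _.
  exact: coord_continuous.
move=> U [P AP PU]; apply: filterS => [x|]; first exact: PU.
apply: filter_forall => i; apply: filter_forall => j.
exact: (fA i j _ (AP i j)).
Qed.

Lemma cvg_near_eq m n (f g : T -> 'M[R]_(m, n)) (A : 'M[R]_(m, n)) :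
  (\forall x \near F, f x = g x) -> f @ F --> A -> g @ F --> A.
Proof. by move=> fg; apply: cvg_trans; exact: near_eq_cvg. Qed.

Lemma cvg_bigprod (I : Type) (r : seq I) (P : pred I) (f : I -> T -> R) (a : I -> R) :
  (forall i, f i x @[x --> F] --> a i) ->
  \prod_(i <- r | P i) f i x @[x --> F] --> \prod_(i <- r | P i) a i.
Proof.
move=> fa; elim: r => [|i r IH].
  under eq_fun do rewrite big_nil.
  by rewrite big_nil; exact: cvg_cst.
under eq_fun do rewrite big_cons.
rewrite big_cons; case: (P i) => //; exact: cvgM.
Qed.

Lemma cvg_bigsum (I : Type) (r : seq I) (P : pred I) (f : I -> T -> R) (a : I -> R) :
  (forall i, f i x @[x --> F] --> a i) ->
  \sum_(i <- r | P i) f i x @[x --> F] --> \sum_(i <- r | P i) a i.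
Proof. by move=> fa; apply: cvg_big => //; exact: add_continuous. Qed.

Lemma cvg_mulmx m n l (f : T -> 'M[R]_(m, n)) (g : T -> 'M[R]_(n, l))
    (A : 'M[R]_(m, n)) (B : 'M[R]_(n, l)) :
  f @ F --> A -> g @ F --> B -> f x *m g x @[x --> F] --> A *m B.
Proof.
move=> /cvg_mxP fA /cvg_mxP gB; apply/cvg_mxP => i j.
under eq_fun do rewrite mxE.
by rewrite mxE; apply: cvg_bigsum => k; apply: cvgM.
Qed.

Lemma cvg_det n (f : T -> 'M[R]_n) (A : 'M[R]_n) :
  f @ F --> A -> \det (f x) @[x --> F] --> \det A.
Proof.
move=> /cvg_mxP fA; apply: cvg_bigsum => s.
by apply: cvgM; [exact: cvg_cst|exact: cvg_bigprod].
Qed.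

Lemma cvg_lsubmx m n1 n2 (f : T -> 'M[R]_(m, n1 + n2)) (A : 'M[R]_(m, n1 + n2)) :
  f @ F --> A -> lsubmx (f x) @[x --> F] --> lsubmx A.
Proof.
move=> /cvg_mxP fA; apply/cvg_mxP => i j.
under eq_fun do rewrite mxE.
by rewrite mxE; apply: fA.
Qed.

Lemma cvg_rsubmx m n1 n2 (f : T -> 'M[R]_(m, n1 + n2)) (A : 'M[R]_(m, n1 + n2)) :
  f @ F --> A -> rsubmx (f x) @[x --> F] --> rsubmx A.
Proof.
move=> /cvg_mxP fA; apply/cvg_mxP => i j.
under eq_fun do rewrite mxE.
by rewrite mxE; apply: fA.
Qed.

Lemma cvg_row_mx m n1 n2 (f : T -> 'M[R]_(m, n1)) (g : T -> 'M[R]_(m, n2))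
    (A : 'M[R]_(m, n1)) (B : 'M[R]_(m, n2)) :
  f @ F --> A -> g @ F --> B -> row_mx (f x) (g x) @[x --> F] --> row_mx A B.
Proof.
move=> /cvg_mxP fA /cvg_mxP gB; apply/cvg_mxP => i j; rewrite -(splitK j).
case: (fintype.split j) => l /=.
  under eq_fun do rewrite row_mxEl.
  by rewrite row_mxEl; exact: fA.
under eq_fun do rewrite row_mxEr.
by rewrite row_mxEr; exact: gB.
Qed.

(** Near the limit the determinant is nonzero, and Cramer's formula expresses the inverse through
    determinants. *)
Lemma cvg_invmx n (f : T -> 'M[R]_n) (A : 'M[R]_n) : A \in unitmx ->
  f @ F --> A -> invmx (f x) @[x --> F] --> invmx A.
Proof.
move=> Au fA; have dA : \det A != 0 by rewrite -unitfE -unitmxE.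
have adjE (M : 'M[R]_n) : \det M != 0 -> (\det M)^-1 *: \adj M = invmx M.
  by move=> dM; rewrite /invmx unitmxE unitfE dM.
have dfA := cvg_det fA.
rewrite -adjE //.
apply: (@cvg_near_eq _ _ (fun x => (\det (f x))^-1 *: \adj (f x))).
  have : \forall x \near F, \det (f x) != 0 by exact: cvgr_neq0 dfA dA.
  by apply: filterS => x; exact: adjE.
apply/cvg_mxP => i j.
under eq_fun do rewrite !mxE.
rewrite !mxE; apply: cvgM; first exact: cvgV.
apply: cvgM; first exact: cvg_cst.
apply: cvg_det; apply/cvg_mxP => k l; under eq_fun do rewrite !mxE.
by rewrite !mxE; move/cvg_mxP : fA; apply.
Qed.

(** Sign preservation near a limit; the product treats both signs of [a] at once. *)
Lemma near_mulr_gt0 (f : T -> R) (a : R) : f x @[x --> F] --> a -> a != 0 ->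
  \forall x \near F, 0 < a * f x.
Proof.
move=> fa a0.
have c : a * f x @[x --> F] --> a * a by apply: cvgM => //; exact: cvg_cst.
by apply: (cvgr_gt _ c); rewrite -expr2 exprn_even_gt0.
Qed.

End MatrixLimits.

(** * The Poincare-Miranda and Leray-Schauder theorems *)

Section FixedPoints.
Set Implicit Arguments. Unset Strict Implicit.
Variables (R : realType) (q : nat).
Implicit Types (x y z : 'rV[R]_q) (r : R).

Lemma ler_rV_norm x r : 0 <= r -> (`|x| <= r) = [forall i, `|x 0 i| <= r].
Proof.
move=> r0; rewrite [`|x|]/Num.norm /= mx_normrE.
apply/bigmax_leP/forallP => [[_ H] i|H]; first exact: (H (0, i)).
by split=> // -[i j] _ /=; rewrite ord1.
Qed.

Lemma compact_rV_ball r : compact [set x : 'rV[R]_q | `|x| <= r].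
Proof.
apply: bounded_closed_compact.
  by exists r; split; [exact: num_real|move=> s rs x /= /le_trans-> //; exact: ltW].
rewrite (_ : [set x : 'rV[R]_q | `|x| <= r] = Num.norm @^-1` [set s | s <= r]) //.
apply: closed_comp; last exact: closed_le.
by move=> x _; exact: norm_continuous.
Qed.

Let gridpt r p (w : 'I_q -> nat) : 'rV[R]_q :=
  \row_i (- r + 2 * r * (w i)%:R / p%:R).

Let gridpt_norm r p w : 0 < r -> (0 < p)%N -> (forall i, w i <= p)%N ->
  `|gridpt r p w| <= r.
Proof.
move=> r0 p0 wp; rewrite ler_rV_norm ?ltW //; apply/forallP => i.
rewrite mxE -mulrA; set s := _ / _.
have s0 : 0 <= s by rewrite divr_ge0.
have s1 : s <= 1 by rewrite ler_pdivrMr ?ltr0n // mul1r ler_nat.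
by rewrite ler_norml; apply/andP; split; nra.
Qed.

Let gridpt_dist r p v w : 0 < r -> (0 < p)%N -> in_cube v w ->
  `|gridpt r p v - gridpt r p w| <= 2 * r / p%:R.
Proof.
move=> r0 p0 vw; have rp0 : 0 <= 2 * r / p%:R.
  by apply: divr_ge0 => //; apply: mulr_ge0 => //; exact: ltW.
rewrite ler_rV_norm //; apply/forallP => i; have /andP[h1 h2] := vw i.
rewrite !mxE (_ : _ - _ = - (2 * r / p%:R * ((w i)%:R - (v i)%:R))); last first.
  by rewrite mulrBr !(mulrAC _ p%:R^-1); ring.
rewrite normrN normrM (ger0_norm rp0) ler_piMr // -natrB // normr_nat.
by rewrite -[leRHS]/(1%:R) ler_nat leq_subLR addn1.
Qed.

(** The norm is the max norm, so the ball is a cube. Without a zero, compactness gives one mesh size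
    at which, around each point, some coordinate of [phi] keeps a strict sign; a grid cell on which
    all sign bits change contradicts this. *)
Theorem poincare_miranda (phi : 'rV[R]_q -> 'rV[R]_q) r : 0 < r ->
  continuous phi ->
  (forall x i, `|x| <= r -> x 0 i = - r -> phi x 0 i <= 0) ->
  (forall x i, `|x| <= r -> x 0 i = r -> 0 <= phi x 0 i) ->
  exists2 x, `|x| <= r & phi x = 0.
Proof.
move=> r0 phic philo phihi; apply/not_exists2P => nozero.
(* [2 * r / p] is the mesh of the grid, which bounds the distance from the lowest vertex of a cell
   to its other vertices. *)
pose P (p : nat) x := ~ forall i, exists x1 x2,
  [/\ `|x - x1| <= 2 * r / p%:R, `|x - x2| <= 2 * r / p%:R,
      phi x1 0 i <= 0 & 0 <= phi x2 0 i].
have phii i : continuous (fun x => phi x 0 i).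
  by move=> x; have /cvg_mxP/(_ 0 i) := phic x.
have key x : `|x| <= r -> \forall x' \near x & p \near \oo, P p x'.
  move=> xr; have [//|/eqP phix] := nozero x.
  have [i phixi] : exists i, phi x 0 i != 0.
    apply/not_existsP => H; apply: (negP phix); apply/eqP/rowP => i.
    by rewrite mxE; apply/eqP/negPn/negP/H.
  have /nbhs_ballP[e /= e0 eP] : nbhs x [set y | 0 < phi x 0 i * phi y 0 i].
    exact: near_mulr_gt0 (phii i x) phixi.
  near=> x' p => H.
  have [x1 [x2 [d1 d2 h1 h2]]] := H i.
  have xx' : ball x (e / 2) x' by near: x'; apply: nbhsx_ballx; rewrite divr_gt0.
  have pe : 2 * r / p%:R < e / 2.
    have pr : 4 * r / e < p%:R by near: p; exact: nbhs_infty_gtr.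
    have p0 : 0 < p%:R :> R by apply: le_lt_trans pr; rewrite divr_ge0 ?ltW ?mulr_gt0.
    by move: pr; rewrite !ltr_pdivrMr // => pr; nra.
  have b1 : ball x e x1.
    rewrite [e]splitr; apply: ball_triangle xx' _.
    by rewrite -ball_normE /=; exact: le_lt_trans d1 pe.
  have b2 : ball x e x2.
    rewrite [e]splitr; apply: ball_triangle xx' _.
    by rewrite -ball_normE /=; exact: le_lt_trans d2 pe.
  have := eP _ b1; have := eP _ b2 => /=; nra.
have [N _ NP] := @iffLR _ _ (compact_near_coveringP _) (@compact_rV_ball r) _ _ P _ key.
pose p := N.+1.
have p0 : (0 < p)%N by [].
have pr0 : (p%:R : R) != 0 by rewrite pnatr_eq0.
(* The bit is the sign of the coordinate inside, and is forced on the two extreme faces, where the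
   hypotheses give only weak inequalities. *)
pose b (i : 'I_q) (w : 'I_q -> nat) : 'F_2 :=
  if w i == 0%N then 0 else if (p <= w i)%N then 1 else (0 < phi (gridpt r p w) 0 i)%R%:R.
have b0 i v : v i = 0%N -> b i v = 0 by rewrite /b => ->.
have b1 i v : v i = p -> b i v = 1 by rewrite /b => ->; rewrite leqnn.
have [v [vp vb]] := cube_changing_bits b0 b1.
have cubep w i : in_cube v w -> (w i <= p)%N.
  by move=> /(_ i) /andP[_ /leq_trans]; apply; exact: vp.
have gn w : in_cube v w -> `|gridpt r p w| <= r.
  by move=> vw; apply: gridpt_norm => // i; exact: cubep.
have := NP p (leqnSn N) (gridpt r p v); apply.
  by apply: gridpt_norm => // i; apply: ltnW.
move=> i; have [w1 [w2 [c1 c2 e1 e2]]] := vb i.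
exists (gridpt r p w1), (gridpt r p w2); split; try exact: gridpt_dist.
- move: e1; rewrite /b; case: eqP => [w10 _|_].
    by apply: philo; [exact: gn|rewrite mxE w10 mulr0 mul0r addr0].
  case: leqP => // _ ; case: ltP => // _ /eqP; by rewrite oner_eq0.
- move: e2; rewrite /b; case: eqP => [//|_].
  case: leqP => [_|pw _].
    by case: ltP => [/ltW//|_ /eqP]; rewrite eq_sym oner_eq0.
  have wE : w2 i = p by apply/eqP; rewrite eqn_leq pw cubep.
  apply: phihi; first exact: gn.
  by rewrite mxE wE mulfK //; lra.
Unshelve. all: by end_near. Qed.

(** For positive [r], the subtracted vector is the radial retraction of [g y] onto the ball of
    radius [r]. *)
Lemma cvg_sub_radial (F : set_system 'rV[R]_q) {FF : Filter F} (g : 'rV[R]_q -> 'rV[R]_q)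
    (a b : 'rV[R]_q) r : F --> a -> g @ F --> b ->
  y - (Num.max 1 (`|g y| / r))^-1 *: g y @[y --> F] -->
  a - (Num.max 1 (`|b| / r))^-1 *: b.
Proof.
move=> Fa gb; apply: cvgB => //; apply: cvgZ => //; apply: cvgV.
  by rewrite gt_eqF // lt_max ltr01.
have ngb : `|g y| / r @[y --> F] --> `|b| / r.
  by apply: cvgM; [exact: cvg_norm|exact: cvg_cst].
under eq_fun do rewrite maxr_absE.
rewrite maxr_absE; apply: cvgM; last exact: cvg_cst.
apply: cvgD; first by apply: cvgD => //; exact: cvg_cst.
by apply: cvg_norm; apply: cvgB => //; exact: cvg_cst.
Qed.

(* Brouwer's theorem for the composition of [g] with the radial retraction onto
   the ball of radius [r], in the guise of Poincare-Miranda. *)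
Theorem leray_schauder (g : 'rV[R]_q -> 'rV[R]_q) r : 0 < r ->
  continuous g ->
  (forall y s, 0 <= s <= 1 -> y = s *: g y -> `|y| < r) ->
  exists y, y = g y.
Proof.
move=> r0 gc bnd.
pose s y := (Num.max 1 (`|g y| / r))^-1.
have m0 y : 0 < Num.max 1 (`|g y| / r) by rewrite lt_max ltr01.
have s01 y : 0 <= s y <= 1.
  by rewrite invr_ge0 ltW //= invf_le1 // le_max lexx.
have sg y : `|s y *: g y| <= r.
  rewrite normrZ ger0_norm; last by have /andP[] := s01 y.
  by rewrite mulrC ler_pdivrMr // mulrC -ler_pdivrMr // le_max lexx orbT.
have sgi y i : - r <= (s y *: g y) 0 i <= r.
  by rewrite -ler_norml; have := sg y; rewrite ler_rV_norm ?(ltW r0) // => /forallP.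
have [y yr] : exists2 y, `|y| <= r & y - s y *: g y = 0.
  apply: poincare_miranda => //.
  - by move=> y; exact: (cvg_sub_radial (@cvg_refl _ (nbhs y)) (gc y)).
  - by move=> y i _ yi; have := sgi y i; rewrite !mxE yi; lra.
  - by move=> y i _ yi; have := sgi y i; rewrite !mxE yi; lra.
move/eqP; rewrite subr_eq0 => /eqP ysg.
exists y; have yltr := bnd y (s y) (s01 y) ysg.
suff s1 : s y = 1 by rewrite {1}ysg s1 scale1r.
(* If [g y] had norm at least [r], its retraction [y] would have norm exactly [r], against the
   strict a priori bound. *)
rewrite /s; case: leP => [gr|_]; rewrite ?invr1 //; exfalso.
have gy0 : 0 < `|g y| / r by exact: lt_le_trans ltr01 gr.
move: yltr; rewrite {1}ysg normrZ /s max_r // normfV normrM normr_id.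
rewrite (ger0_norm (ltW _)) ?invr_gt0 // invfM invrK -mulrA mulrCA mulVf ?mulr1 ?ltxx //.
by apply: contraTneq gy0 => ->; rewrite mul0r ltxx.
Qed.

End FixedPoints.

(** * Planes and graphs *)

Section Planes.
Set Implicit Arguments. Unset Strict Implicit.
Variable R : realType.

Lemma op_eqI n k (P Q : oplane R n k) (G : 'M[R]_k) :
  op_pts P (op_pt Q) -> 0 < \det G -> op_dir Q = G *m op_dir P -> op_eq P Q.
Proof.
move=> [t0 Qt0] G0 dQ; split; last by exists G.
have Gu : G \in unitmx by rewrite unitmxE unitfE gt_eqF.
apply/seteqP; split=> x [t ->].
  exists ((t - t0) *m invmx G).
  by rewrite Qt0 dQ mulmxA mulmxKV // -addrA -mulmxDl (addrC t0) subrK.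
by exists (t0 + t *m G); rewrite Qt0 dQ mulmxDl addrA mulmxA.
Qed.

Lemma op_eq_refl n k (P : oplane R n k) : op_eq P P.
Proof. by split=> //; exists 1%:M; rewrite det1 mul1mx. Qed.

Lemma op_pt_in n k (P : oplane R n k) : op_pts P (op_pt P).
Proof. by exists 0; rewrite mul0mx addr0. Qed.

(** When the left block of [M] is invertible, the row space of [M] is the graph of
    [t |-> t *m slope M]. *)
Definition slope k q (M : 'M[R]_(k, k + q)) := invmx (lsubmx M) *m rsubmx M.

(** The second component of the point where the plane through [p] with frame [M] meets [{0} x R^q],
    again for an invertible left block. *)
Definition foot k q (p : 'rV[R]_(k + q)) (M : 'M[R]_(k, k + q)) :=
  rsubmx p - lsubmx p *m slope M.

Lemma slopeM k q (G : 'M[R]_k) (M : 'M[R]_(k, k + q)) :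
  G \in unitmx -> lsubmx M \in unitmx -> slope (G *m M) = slope M.
Proof.
move=> Gu Mu; rewrite /slope -mulmx_lsub -mulmx_rsub.
have GM : G *m lsubmx M \in unitmx by rewrite unitmx_mul Gu.
apply: (can_inj (mulKmx GM)).
by rewrite mulKVmx // -!mulmxA mulKVmx.
Qed.

Lemma cvg_slope k q T (F : set_system T) {FF : Filter F}
    (f : T -> 'M[R]_(k, k + q)) (M : 'M[R]_(k, k + q)) :
  lsubmx M \in unitmx -> f @ F --> M -> slope (f x) @[x --> F] --> slope M.
Proof.
move=> Mu fM; apply: cvg_mulmx; last exact: cvg_rsubmx.
by apply: cvg_invmx => //; exact: cvg_lsubmx.
Qed.

Lemma cvg_foot k q T (F : set_system T) {FF : Filter F}
    (g : T -> 'rV[R]_(k + q)) (p : 'rV[R]_(k + q))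
    (f : T -> 'M[R]_(k, k + q)) (M : 'M[R]_(k, k + q)) :
  lsubmx M \in unitmx -> g @ F --> p -> f @ F --> M ->
  foot (g x) (f x) @[x --> F] --> foot p M.
Proof.
move=> Mu gp fM; apply: cvgB; first exact: cvg_rsubmx.
by apply: cvg_mulmx; [exact: cvg_lsubmx|exact: cvg_slope].
Qed.

Lemma norm_le_eucl n (v : 'rV[R]_n) : `|v| <= eucl_norm v.
Proof.
rewrite ler_rV_norm ?sqrtr_ge0 //; apply/forallP => i.
rewrite -sqrtr_sqr; apply: ler_wsqrtr.
by rewrite (bigD1 i) //= lerDl sumr_ge0 // => j _; exact: sqr_ge0.
Qed.

Lemma eucl_normZ n (s : R) (v : 'rV[R]_n) : eucl_norm (s *: v) = `|s| * eucl_norm v.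
Proof.
rewrite /eucl_norm -[`|s|]sqrtr_sqr -sqrtrM ?sqr_ge0 // mulr_sumr.
by congr Num.sqrt; apply: eq_bigr => i _; rewrite mxE exprMn.
Qed.

Lemma cvg_eucl_norm n T (F : set_system T) {FF : Filter F} (f : T -> 'rV[R]_n)
    (v : 'rV[R]_n) : f @ F --> v -> eucl_norm (f x) @[x --> F] --> eucl_norm v.
Proof.
move=> /cvg_mxP fv; apply: (cvg_comp _ Num.sqrt); last exact: sqrt_continuous.
by apply: cvg_bigsum => i; apply: cvgM; exact: fv.
Qed.

End Planes.

(** * Families of graphs: fibration and skewness against conditions (i) and (ii) *)

Section Graphs.
Set Implicit Arguments. Unset Strict Implicit.
Variables (R : realType) (k q : nat) (B : 'rV[R]_q -> 'M[R]_(k, q)).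

Lemma op_pts_PyE y x :
  op_pts (Py B y) x <-> rsubmx x = y + lsubmx x *m B y.
Proof.
split=> [[t ->]|xE] /=.
  by rewrite mul_mx_row add_row_mx row_mxKr row_mxKl mulmx1 add0r.
exists (lsubmx x).
by rewrite /= mul_mx_row add_row_mx mulmx1 add0r -xE hsubmxK.
Qed.

Lemma Py_foot y : op_pts (Py B y) (row_mx 0 y).
Proof. exact: op_pt_in. Qed.

Lemma Py_inj y y' : op_eq (Py B y) (Py B y') -> y = y'.
Proof.
move=> [yy' _]; have := Py_foot y.
by rewrite yy' op_pts_PyE row_mxKr row_mxKl mul0mx addr0.
Qed.

(** Slope and foot do not depend on the frame, so the local frames in the definition of a fibration
    determine [y] and [B y]. *)
Lemma op_eq_Py_frame y p M : op_eq (Py B y) (OPlane p M) ->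
  [/\ lsubmx M \in unitmx, slope M = B y & foot p M = y].
Proof.
move=> [pts [G [/= G0 ->]]]; rewrite mul_mx_row mulmx1 row_mxKl.
have Gu : G \in unitmx by rewrite unitmxE unitfE gt_eqF.
have sE : slope (row_mx G (G *m B y)) = B y.
  by rewrite /slope row_mxKl row_mxKr mulKmx.
split=> //; rewrite /foot sE.
have := op_pt_in (OPlane p M); rewrite -pts /= op_pts_PyE => ->.
by rewrite addrK.
Qed.

Lemma dist0_le y p : op_pts (Py B y) p -> dist0 B y <= eucl_norm p.
Proof.
move=> yp; apply: ge_inf; last by exists p.
by exists 0 => _ [z _ <-]; exact: sqrtr_ge0.
Qed.

Lemma dist0_lt y M : dist0 B y < M -> exists2 p, op_pts (Py B y) p & eucl_norm p < M.
Proof.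
move=> /inf_lt[|_ [p yp <-] pM]; last by exists p.
by exists (eucl_norm (row_mx (0 : 'rV[R]_k) y)), (row_mx 0 y) => //; exact: Py_foot.
Qed.

Let Fib := [set Py B y | y in [set: 'rV[R]_q]].

(** Locally [Y] is the foot of a continuous frame, and [foot] is continuous where the left block is
    invertible. *)
Lemma fibration_foot : is_fibration Fib ->
  exists2 Y : 'rV[R]_(k + q) -> 'rV[R]_q, continuous Y &
    forall x y, op_pts (Py B y) x <-> y = Y x.
Proof.
move=> [_ cov disj cont].
have /choice[Y YP] x : exists y, op_pts (Py B y) x.
  by have [_ [y _ <-] yx] := cov x; exists y.
have YU x y : op_pts (Py B y) x <-> y = Y x.
  split=> [yx|->//]; apply: Py_inj.
  by apply: disj; [exists y|exists (Y x)|exists x; split].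
exists Y => // x0; have [U [oU Ux0 [p [M [pMc PE]]]]] := cont x0.
have YE x : U x -> lsubmx (M x) \in unitmx /\ foot (p x) (M x) = Y x.
  move=> /PE[_ [y _ <-] [/YU-> /op_eq_Py_frame[]]]; by [].
have [M0 Y0] := YE x0 Ux0; have [pc Mc] := pMc x0 Ux0.
have nU : nbhs x0 U by apply: open_nbhs_nbhs.
rewrite /continuous_at -Y0; apply: cvg_near_eq (cvg_foot M0 pc Mc).
by apply: filterS nU => x /YE[].
Qed.

(** A kernel vector [(t, l)] with [l = 0] gives a common direction of two fibers, excluded by
    skewness unless [t = 0]; if [l] is nonzero, scaling it to [1] gives a common point over
    [t / l]. *)
Lemma fibration_distinct_ker : is_fibration Fib -> skew_family Fib ->
  forall x y, x != y -> forall w : 'rV[R]_(k + 1),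
    w *m (Amat B x - Amat B y) = 0 -> w = 0.
Proof.
move=> /fibration_foot[Y _ YU] skew x y xy w.
rewrite -[w]hsubmxK /Amat opp_col_mx add_col_mx mul_row_col.
set t := lsubmx w; set l := rsubmx w.
have lE (z : 'rV[R]_q) : l *m z = l 0 0 *: z.
  by rewrite [l]mx11_scalar mul_scalar_mx !mxE eqxx mulr1n.
have [l0|l0] := eqVneq (l 0 0) 0.
  rewrite lE l0 scale0r addr0 mulmxBr => /eqP; rewrite subr_eq0 => /eqP tB.
  have l00 : l = 0 by rewrite [l]mx11_scalar l0 raddf0.
  suff : row_mx t (t *m B x) = 0.
    by move=> /eqP; rewrite row_mx_eq0 => /andP[/eqP-> _]; rewrite l00 row_mx0.
  apply: (skew (Py B x) (Py B y)); [by exists x|by exists y| | |].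
  - by move/Py_inj/eqP; rewrite (negPf xy).
  - by apply/submxP; exists t; rewrite mul_mx_row mulmx1.
  - by apply/submxP; exists t; rewrite tB mul_mx_row mulmx1.
rewrite lE => /(congr1 (fun v => (l 0 0)^-1 *: v)).
rewrite scalerDr scalerA mulVf // scale1r scaler0 mulmxBr scalerBr !scalemxAl.
set s := _ *: t => H; case/eqP: xy.
have E : x + s *m B x = y + s *m B y.
  by apply/eqP; rewrite -subr_eq0 opprD addrACA addrC H.
have h1 : op_pts (Py B x) (row_mx s (x + s *m B x)).
  by rewrite op_pts_PyE row_mxKl row_mxKr.
have h2 : op_pts (Py B y) (row_mx s (x + s *m B x)).
  by rewrite op_pts_PyE row_mxKl row_mxKr.
by move/YU: h1 ->; move/YU: h2 ->.
Qed.

(** Each [Y x] has a neighbourhood that [u] eventually avoids; by continuity of [Y] and compactness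
    of a ball, one index serves for all [x] in the ball. *)
Lemma fibration_dist : is_fibration Fib -> forall u : nat -> 'rV[R]_q,
  no_accum u -> forall M : R, \forall m \near \oo, M < dist0 B (u m).
Proof.
move=> /fibration_foot[Y Yc YU] u nu M.
pose P (m : nat) x := ~ Y x = u m.
have key x : `|x| <= M + 1 -> \forall x' \near x & m \near \oo, P m x'.
  move=> _; have [U Ux Um] := nu (Y x).
  have nU := Yc x _ Ux.
  near=> x' m.
  have UY : U (Y x') by near: x'.
  have NU : ~ U (u m) by near: m.
  by move=> YE; apply: NU; rewrite -YE.
have [N _ NP] := @iffLR _ _ (compact_near_coveringP _)
  (@compact_rV_ball R (k + q) (M + 1)) _ _ P _ key.
exists N => // m /NP HP /=; rewrite ltNge; apply/negP => dM.
(* The added [1] leaves room for a point of the plane that only approximates the infimum. *)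
have [|p up pM] := @dist0_lt (u m) (M + 1).
  by apply: le_lt_trans dM _; rewrite ltrDl.
apply: (HP p) => /=; last by symmetry; apply/YU.
by apply: le_trans (norm_le_eucl p) _; exact: ltW.
Unshelve. all: by end_near. Qed.

Hypothesis Bc : continuous B.

(** Otherwise there is a sequence with distances at most [M] and [u n] of norm at least [n]; it
    leaves every ball, hence has no accumulation point. *)
Lemma dist_bounded : (forall u : nat -> 'rV[R]_q, no_accum u ->
    forall M : R, \forall m \near \oo, M < dist0 B (u m)) ->
  forall M, exists2 r, 0 < r & forall y, dist0 B y <= M -> `|y| < r.
Proof.
move=> dinf M; apply/not_exists2P => unb.
have /choice[u uP] (n : nat) : exists y, dist0 B y <= M /\ n%:R <= `|y|.
  have [|/existsNP[y /not_implyP[yM /negP]]] := unb n.+1%:R.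
    by rewrite ltr0Sn.
  rewrite -leNgt => ny; exists y; split=> //; apply: le_trans ny.
  by rewrite ler_nat.
have nu : no_accum u.
  move=> z; exists (ball z 1); first exact: nbhsx_ballx.
  near=> m => zu.
  have mz : `|z| + 1 < m%:R by near: m; exact: nbhs_infty_gtr.
  have := (uP m).2; rewrite leNgt => /negP; apply; apply: le_lt_trans mz.
  move: zu; rewrite -ball_normE /= distrC => /ltW zu.
  by rewrite -[u m](subrK z) addrC (le_trans (ler_normD _ _)) // lerD2l.
have [N _ NP] := dinf u nu M.
by have /= := NP N (leqnn N); rewrite ltNge (uP N).1.
Unshelve. all: by end_near. Qed.

Lemma cvg_graph T (F : set_system T) {FF : Filter F} (f : T -> 'rV[R]_k)
    (g : T -> 'rV[R]_q) (t : 'rV[R]_k) (y : 'rV[R]_q) :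
  f @ F --> t -> g @ F --> y ->
  g x + f x *m B (g x) @[x --> F] --> y + t *m B y.
Proof.
move=> ft gy; apply: cvgD => //; apply: cvg_mulmx => //.
exact: (cvg_comp g B gy (@Bc y)).
Qed.

Lemma cvg_solve (F : set_system 'rV[R]_q) {FF : Filter F} (t : 'rV[R]_k) (z y : 'rV[R]_q) :
  F --> y -> z - t *m B x @[x --> F] --> z - t *m B y.
Proof.
move=> Fy; apply: cvgB; first exact: cvg_cst.
apply: cvg_mulmx; first exact: cvg_cst.
exact: (cvg_comp id B Fy (@Bc y)).
Qed.

Hypothesis ker0 : forall x y : 'rV[R]_q, x != y ->
  forall w : 'rV[R]_(k + 1), w *m (Amat B x - Amat B y) = 0 -> w = 0.
Hypothesis bnd : forall M, exists2 r, 0 < r & forall y, dist0 B y <= M -> `|y| < r.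

(** A common point over [t] puts [(t, 1)] into the kernel of the difference. *)
Lemma ker_pts_inj p y y' : op_pts (Py B y) p -> op_pts (Py B y') p -> y = y'.
Proof.
rewrite !op_pts_PyE => -> E; apply/eqP/negPn/negP => /ker0/(_ (row_mx (lsubmx p) 1%:M)).
rewrite /Amat opp_col_mx add_col_mx mul_row_col mul1mx mulmxBr => H.
have : row_mx (lsubmx p) (1%:M : 'M[R]_1) = 0.
  by apply: H; rewrite addrC addrACA -opprD E subrr.
move=> /eqP; rewrite row_mx_eq0 => /andP[_ /eqP/matrixP/(_ 0 0)].
by rewrite !mxE => /eqP; rewrite oner_eq0.
Qed.

Lemma pts_cover p : exists y, op_pts (Py B y) p.
Proof.
pose t := lsubmx p; pose z := rsubmx p.
have [r r0 rP] := bnd (eucl_norm p).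
have gc : continuous (fun y => z - t *m B y).
  by move=> y; exact: cvg_solve (@cvg_refl _ (nbhs y)).
have [y s /andP[s0 s1] yE|y yE] := leray_schauder r0 gc.
  apply: rP; apply: le_trans (_ : eucl_norm (s *: p) <= _).
    apply: dist0_le; rewrite op_pts_PyE !linearZ /= -scalemxAl.
    by rewrite {1}yE scalerBr subrK.
  by rewrite eucl_normZ ger0_norm // ler_piMl // sqrtr_ge0.
by exists y; rewrite op_pts_PyE -/t -/z {1}yE subrK.
Qed.

(** A closed graph argument: for [p] near [p0] the distance bound confines [Y p] to one compact
    ball, and near any [y] other than [Y p0] the equation of [P_y] at [p] keeps failing. *)
Lemma continuous_pts_foot (Y : 'rV[R]_(k + q) -> 'rV[R]_q) :
  (forall p, op_pts (Py B (Y p)) p) -> continuous Y.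
Proof.
move=> YP p0 V VY.
have [r r0 rP] := bnd (eucl_norm p0 + 1).
pose P (p : 'rV[R]_(k + q)) y := rsubmx p = y + lsubmx p *m B y -> V y.
have key y : `|y| <= r -> \forall y' \near y & p \near p0, P p y'.
  move=> _; have [->|yY] := eqVneq y (Y p0).
    near=> y' p.
    have Vy' : V y' by near: y'.
    by [].
  have h0 : y + lsubmx p0 *m B y - rsubmx p0 != 0.
    rewrite subr_eq0; apply: contraNneq yY => E.
    by apply/eqP/(@ker_pts_inj p0) => //; rewrite op_pts_PyE.
  have c : x.1 + lsubmx x.2 *m B x.1 - rsubmx x.2 @[x --> filter_prod (nbhs y) (nbhs p0)]
      --> y + lsubmx p0 *m B y - rsubmx p0.
    apply: cvgB; last by apply: cvg_rsubmx; exact: cvg_snd.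
    by apply: cvg_graph; [apply: cvg_lsubmx; exact: cvg_snd|exact: cvg_fst].
  have : \forall x \near filter_prod (nbhs y) (nbhs p0),
      x.1 + lsubmx x.2 *m B x.1 - rsubmx x.2 != 0 by exact: cvgr_neq0 c h0.
  by apply: filterS => -[y' p] /= + E; rewrite E subrr eqxx.
have HP := @iffLR _ _ (compact_near_coveringP _) (@compact_rV_ball R q r) _ _ P _ key.
have ec : \forall p \near p0, eucl_norm p < eucl_norm p0 + 1.
  have c : eucl_norm p @[p --> nbhs p0] --> eucl_norm p0 by exact: cvg_eucl_norm cvg_refl.
  by apply: (cvgr_lt _ c); rewrite ltrDl.
suff : \forall p \near p0, V (Y p) by [].
near=> p.
have Kp : [set y | `|y| <= r] `<=` P p by near: p; exact: HP.
have pe : eucl_norm p < eucl_norm p0 + 1 by near: p.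
have pY := YP p; apply: (Kp (Y p)) => /=; last exact/op_pts_PyE.
by apply/ltW/rP; apply: le_trans (dist0_le pY) _; exact: ltW.
Unshelve. all: by end_near. Qed.

Lemma graph_fibration : is_fibration Fib.
Proof.
have /choice[Y YP] := pts_cover.
split=> [_ [y _ <-]|p|_ _ [y _ <-] [y' _ <-] [p [yp y'p]]|p0].
- rewrite -kermx_eq0 -submx0; apply/rV_subP => v /sub_kermxP.
  by rewrite mul_mx_row mulmx1 => /eqP; rewrite row_mx_eq0 => /andP[/eqP-> _]; rewrite sub0mx.
- by exists (Py B (Y p)) => //; exists (Y p).
- by rewrite (ker_pts_inj yp y'p); exact: op_eq_refl.
exists setT; split=> //; first exact: openT.
exists (fun p => row_mx 0 (Y p)), (fun p => row_mx 1%:M (B (Y p))); split=> [p _|p _].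
  have Yc : Y @ nbhs p --> Y p by exact: continuous_pts_foot.
  have BYc : B (Y x) @[x --> nbhs p] --> B (Y p).
    exact: (cvg_comp Y B Yc (@Bc (Y p))).
  split; first exact: (cvg_row_mx (cvg_cst _) Yc).
  exact: (cvg_row_mx (cvg_cst _) BYc).
by exists (Py B (Y p)); [exists (Y p)|split; [exact: YP|exact: op_eq_refl]].
Qed.

(** A common direction over [t] puts [(t, 0)] into the kernel of the difference. *)
Lemma graph_skew : skew_family Fib.
Proof.
move=> _ _ [x _ <-] [y _ <-] neq v /submxP[t ->] /submxP[t'].
have [xy|/ker0 kxy] := eqVneq x y; first by case: neq; rewrite xy; exact: op_eq_refl.
rewrite !mul_mx_row !mulmx1 => /eq_row_mx[<- tB].
have : row_mx t (0 : 'M[R]_1) = 0.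
  apply: kxy; rewrite /Amat opp_col_mx add_col_mx mul_row_col mul0mx addr0.
  by rewrite mulmxBr tB subrr.
by move=> /eqP; rewrite row_mx_eq0 => /andP[/eqP-> _]; rewrite mul0mx row_mx0.
Qed.

End Graphs.

(** * Orthonormal frames and fibrations transverse to a plane *)

Section OrthonormalFrames.
Set Implicit Arguments. Unset Strict Implicit.
Variable R : realType.

(** Induction on the rows: orthonormalize the tail, subtract from the first row its projection onto
    the tail, and normalize. [G] records the row operations. *)
Lemma gram_schmidt m n (A : 'M[R]_(m, n)) : row_free A ->
  exists2 G : 'M[R]_m, G \in unitmx & (G *m A) *m (G *m A)^T = 1%:M.
Proof.
elim: m A => [|m IH] A Af.
  by exists 1%:M; [exact: unitmx1|rewrite [LHS]flatmx0 [RHS]flatmx0].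
change 'M[R]_(1 + m, n) in A.
pose a := usubmx A; pose A' := dsubmx A.
have AE : A = col_mx a A' by rewrite vsubmxK.
have A'f : row_free A'.
  apply: inj_row_free => v vA'.
  have : row_mx (0 : 'M[R]_1) v *m A = 0 by rewrite AE mul_row_col mul0mx add0r.
  by move/eqP; rewrite mulmx_free_eq0 // row_mx_eq0 => /andP[_ /eqP].
have [G' G'u EE] := IH A' A'f; set E := G' *m A' in EE.
pose a' := a - a *m E^T *m E.
have a'n0 : a' != 0.
  apply/eqP => a'0.
  have : row_mx (1%:M : 'M[R]_1) (- (a *m E^T *m G')) *m A = 0.
    by rewrite AE mul_row_col mul1mx mulNmx -(mulmxA (a *m E^T)); exact: a'0.
  move/eqP; rewrite mulmx_free_eq0 // row_mx_eq0 => /andP[/eqP/matrixP/(_ 0 0)].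
  by rewrite !mxE => /eqP; rewrite oner_eq0.
have a'E : a' *m E^T = 0 by rewrite mulmxBl -(mulmxA (a *m E^T)) EE mulmx1 subrr.
pose s := (a' *m a'^T) 0 0.
have sE : s = \sum_i a' 0 i ^+ 2.
  by rewrite /s mxE; apply: eq_bigr => i _; rewrite [X in _ * X]mxE expr2.
have s0 : 0 < s.
  rewrite sE lt_def sumr_ge0 ?andbT => [|i _]; last exact: sqr_ge0.
  apply: contra_neq a'n0 => /eqP; rewrite psumr_eq0 => [|i _]; last exact: sqr_ge0.
  move=> /allP H; apply/rowP => i; rewrite [RHS]mxE; apply/eqP.
  by have := H i (mem_index_enum _); rewrite /= sqrf_eq0.
pose c := (Num.sqrt s)^-1.
have cs : c * s * c = 1.
  rewrite mulrC mulrA -invfM -expr2 sqr_sqrtr ?(ltW s0) // mulVf //.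
  by rewrite gt_eqF.
have c0 : c != 0 by rewrite invr_eq0 gt_eqF // sqrtr_gt0.
(* Its first row produces [c *: a'] from the rows of [A]; block triangularity makes it
   invertible. *)
pose G : 'M[R]_(1 + m) := block_mx c%:M (- (c *: (a *m E^T *m G'))) 0 G'.
have GA : G *m A = col_mx (c *: a') E.
  rewrite AE mul_block_col mul_scalar_mx mul0mx add0r mulNmx -scalemxAl -(mulmxA (a *m E^T)).
  by rewrite -scalerBr.
suff [Gu GE] : G \in unitmx /\ (G *m A) *m (G *m A)^T = 1%:M by exists G.
split.
  by rewrite unitmxE (@det_ublock _ 1 m) det_scalar1 unitrM unitfE c0 -unitmxE.
rewrite GA tr_col_mx mul_col_row linearZ /= -!scalemxAl -!scalemxAr a'E.
have -> : E *m a'^T = 0 by rewrite -[LHS]trmxK trmx_mul trmxK a'E trmx0.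
rewrite !scaler0 EE scalerA [a' *m _]mx11_scalar -/s scale_scalar_mx.
by rewrite mulrAC cs -scalar_mx_block.
Qed.

(** [F] is an orthonormal basis of the orthogonal complement of the row space of [D], obtained as
    the kernel of [E^T], of dimension [k]. *)
Lemma orthonormal_extension k q (D : 'M[R]_(q, k + q)) : row_free D ->
  exists (F : 'M[R]_(k, k + q)) (G : 'M[R]_q), [/\ G \in unitmx, F *m F^T = 1%:M,
    F *m (G *m D)^T = 0 & (G *m D) *m (G *m D)^T = 1%:M].
Proof.
move=> /gram_schmidt[G Gu]; set E := G *m D => EE.
have Ef : row_free E by apply/row_freeP; exists E^T.
have rk : \rank (kermx E^T) = k.
  by rewrite mxrank_ker mxrank_tr (eqP Ef) addnK.
have [K Kf KE] : exists2 K : 'M[R]_(k, k + q), row_free K & K *m E^T = 0.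
  have KE : row_base (kermx E^T) *m E^T = 0 by apply/sub_kermxP; rewrite eq_row_base.
  move: (row_base (kermx E^T)) (row_base_free (kermx E^T)) KE.
  by rewrite rk => K ? ?; exists K.
have [H Hu FF] := gram_schmidt Kf.
by exists (H *m K), G; split=> //; rewrite -mulmxA KE mulmx0.
Qed.

Lemma reflection k : (0 < k)%N ->
  exists2 J : 'M[R]_k, J *m J^T = 1%:M & \det J = -1.
Proof.
case: k => // k _; pose J : 'M[R]_(1 + k) := block_mx (-1)%:M 0 0 1%:M.
suff [JJ dJ] : J *m J^T = 1%:M /\ \det J = -1 by exists J.
split.
  rewrite tr_block_mx mulmx_block !tr_scalar_mx !trmx0 !mulmx0 !mul0mx !addr0 !add0r.
  by rewrite mulmx1 -scalar_mxM mulrNN mulr1 -scalar_mx_block.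
by rewrite (@det_ublock _ 1 k) det1 det_scalar1 mulr1.
Qed.

(** Intermediate value theorem along the segment from [x] to [y]. *)
Lemma nonvanishing_same_sign n (s : 'rV[R]_n -> R) : continuous s ->
  (forall x, s x != 0) -> forall x y, 0 < s x * s y.
Proof.
move=> sc sn0 x y; rewrite lt_def mulf_neq0 //= leNgt; apply/negP => sxy.
pose f (t : R) := s (x + t *: (y - x)).
have fc : continuous f.
  move=> t; apply: (cvg_comp (fun t : R => x + t *: (y - x)) s); last exact: sc.
  apply: cvgD; first exact: cvg_cst.
  by apply: cvgZr_tmp; exact: cvg_id.
have f0 : f 0 = s x by rewrite /f scale0r addr0.
have f1 : f 1 = s y by rewrite /f scale1r addrC subrK.
have [||c _ fc0] := @IVT R f 0 1 0 ler01 _ _.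
- exact: continuous_subspaceT.
- rewrite f0 f1 ge_min le_max.
  case: (ltgtP (s x) 0) (sn0 x) sxy => // h _.
    by rewrite nmulr_rlt0 // => h'; rewrite (ltW h') orbT.
  by rewrite pmulr_rlt0 // => h'; rewrite (ltW h').
by move: (sn0 (x + c *: (y - x))); rewrite -/(f c) fc0 eqxx.
Qed.

End OrthonormalFrames.

(** * Fibrations with a transverse plane: orientation sign and continuity of slopes *)

Section TransverseFibrations.
Set Implicit Arguments. Unset Strict Implicit.
Variables (R : realType) (k q : nat) (Fib : set (oplane R (k + q) k)).
Hypothesis fibF : is_fibration Fib.

Lemma fibre_choice : exists c : 'rV[R]_(k + q) -> oplane R (k + q) k,
  [/\ forall x, Fib (c x), forall x, op_pts (c x) x &
      forall P x, Fib P -> op_pts P x -> op_eq P (c x)].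
Proof.
have [_ cov disj _] := fibF.
have /choice[c cP] x : exists P, Fib P /\ op_pts P x.
  by have [P FP Px] := cov x; exists P.
exists c; split=> [x|x|P x FP Px]; [exact: (cP x).1|exact: (cP x).2|].
by apply: disj => //; [exact: (cP x).1|exists x; split; [|exact: (cP x).2]].
Qed.

(** Oriented equality preserves the sign of the determinant, so the sign at [x] can be read off a
    local continuous frame; it is thus a continuous function without zeros. *)
Lemma fibre_det_sign (F : 'M[R]_(k, k + q)) :
  (forall P, Fib P -> op_dir P *m F^T \in unitmx) ->
  (forall P, Fib P -> 0 < \det (op_dir P *m F^T)) \/
  (forall P, Fib P -> \det (op_dir P *m F^T) < 0).
Proof.
move=> Fu; have [c [cF cx cU]] := fibre_choice.
pose d (P : oplane R (k + q) k) := \det (op_dir P *m F^T).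
have d0 P : Fib P -> d P != 0 by move=> /Fu; rewrite unitmxE unitfE.
have sgE P Q : op_eq P Q -> Num.sg (d Q) = Num.sg (d P).
  by move=> [_ [G [G0 dQ]]]; rewrite /d dQ -mulmxA det_mulmx sgrM gtr0_sg // mul1r.
pose s x := Num.sg (d (c x)).
have sc : continuous s.
  move=> x0; have [_ _ _ /(_ x0)[U [oU Ux0 [p [M [pMc PE]]]]]] := fibF.
  have nU : nbhs x0 U by apply: open_nbhs_nbhs.
  have sE x : U x -> s x = Num.sg (\det (M x *m F^T)).
    move=> /PE[P FP [Px PM]].
    by rewrite /s (sgE _ _ (cU _ _ FP Px)) -(sgE _ _ PM).
  have [_ Mc] := pMc x0 Ux0.
  have dc : \det (M x *m F^T) @[x --> nbhs x0] --> \det (M x0 *m F^T).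
    by apply: cvg_det; exact: cvg_mulmx Mc (cvg_cst _).
  have dM0 : \det (M x0 *m F^T) != 0 by rewrite -sgr_eq0 -sE // sgr_eq0 d0.
  suff H : \forall x \near nbhs x0, s x = s x0 by exact: cvg_near_cst H.
  have dM := near_mulr_gt0 dc dM0.
  near=> x.
  have Ux : U x by near: x.
  have : 0 < \det (M x0 *m F^T) * \det (M x *m F^T) by near: x; exact: dM.
  rewrite !sE //.
  case: (ltgtP (\det (M x0 *m F^T)) 0) dM0 => // h _.
    by rewrite nmulr_rgt0 // => h'; rewrite !ltr0_sg.
  by rewrite pmulr_rgt0 // => h'; rewrite !gtr0_sg.
have sn0 x : s x != 0 by rewrite sgr_eq0 d0.
have ss := nonvanishing_same_sign sc sn0.
have sP P : Fib P -> Num.sg (d P) = s (op_pt P).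
  by move=> FP; apply/esym/sgE/cU => //; exact: op_pt_in.
case: (ltgtP (s 0) 0) (sn0 0) => // h _; [right|left] => P FP.
  by rewrite -sgr_lt0 -/(d P) sP // -(nmulr_rgt0 _ h).
by rewrite -sgr_gt0 -/(d P) sP // -(pmulr_rgt0 _ h).
Unshelve. all: by end_near. Qed.

(** The representatives [c x] may vary discontinuously, but the slope is the same for a local
    continuous frame. *)
Lemma fibre_slope_continuous (Q : 'M[R]_(k + q)) (c : 'rV[R]_(k + q) -> oplane R (k + q) k) :
  (forall P x, Fib P -> op_pts P x -> op_eq P (c x)) ->
  (forall P, Fib P -> lsubmx (op_dir P *m Q) \in unitmx) ->
  continuous (fun x => slope (op_dir (c x) *m Q)).
Proof.
move=> cU Qu x0; have [_ _ _ /(_ x0)[U [oU Ux0 [p [M [pMc PE]]]]]] := fibF.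
have nU : nbhs x0 U by apply: open_nbhs_nbhs.
have ME x : U x -> lsubmx (M x *m Q) \in unitmx /\
    slope (M x *m Q) = slope (op_dir (c x) *m Q).
  have sG (P S : oplane R (k + q) k) : Fib P -> op_eq P S ->
      lsubmx (op_dir S *m Q) \in unitmx /\ slope (op_dir S *m Q) = slope (op_dir P *m Q).
    move=> FP [_ [G [G0 ->]]]; have Gu : G \in unitmx by rewrite unitmxE unitfE gt_eqF.
    by rewrite -mulmxA -mulmx_lsub unitmx_mul Gu Qu // slopeM // Qu.
  move=> /PE[P FP [Px PM]].
  by have [] := sG _ _ FP (cU _ _ FP Px); have [/= ? ->] := sG _ _ FP PM.
have [_ Mc] := pMc x0 Ux0; have [u0 E0] := ME x0 Ux0.
have MQc : M x *m Q @[x --> nbhs x0] --> M x0 *m Q by exact: cvg_mulmx Mc (cvg_cst _).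
rewrite /continuous_at -E0; apply: cvg_near_eq (cvg_slope u0 MQc).
by apply: filterS nU => x /ME[].
Qed.

Lemma op_img_mem n m (Q : 'M[R]_n) (c x : 'rV[R]_n) (P : oplane R n m) :
  op_pts P x -> op_pts (op_img Q c P) (x *m Q + c).
Proof.
by move=> [t ->]; exists t; rewrite /= mulmxDl mulmxA addrAC.
Qed.

(** Multiplying the frame by the inverse of its left block gives [(1, B y)], and the positive
    determinant preserves the orientation. *)
Lemma op_eq_graph (P : oplane R (k + q) k) (B : 'rV[R]_q -> 'M[R]_(k, q)) y :
  0 < \det (lsubmx (op_dir P)) -> slope (op_dir P) = B y ->
  op_pts P (row_mx 0 y) -> op_eq P (Py B y).
Proof.
move=> d0 sB Py0; have Lu : lsubmx (op_dir P) \in unitmx by rewrite unitmxE unitfE gt_eqF.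
apply: (@op_eqI _ _ _ _ _ (invmx (lsubmx (op_dir P)))) => //=.
  by rewrite det_inv invr_gt0.
by rewrite -{2}[op_dir P]hsubmxK mul_mx_row mulVmx // -sB.
Qed.

Lemma op_pts_foot (P : oplane R (k + q) k) : lsubmx (op_dir P) \in unitmx ->
  op_pts P (row_mx 0 (foot (op_pt P) (op_dir P))).
Proof.
move=> Lu; exists (- (lsubmx (op_pt P) *m invmx (lsubmx (op_dir P)))).
rewrite -{2}[op_pt P]hsubmxK -{3}[op_dir P]hsubmxK !mul_mx_row add_row_mx.
by rewrite /foot /slope !mulNmx mulmxKV // subrr mulmxA.
Qed.

Lemma oriented_frame (T : oplane R (k + q) q) :
  row_free (op_dir T) -> transverse_all Fib T ->
  exists (F : 'M[R]_(k, k + q)) (G : 'M[R]_q), [/\ G \in unitmx, F *m F^T = 1%:M,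
    F *m (G *m op_dir T)^T = 0, (G *m op_dir T) *m (G *m op_dir T)^T = 1%:M &
    forall P, Fib P -> 0 < \det (op_dir P *m F^T)].
Proof.
move=> /orthonormal_extension[F [G [Gu FF FE EE]]] tr.
set E := G *m op_dir T in FE EE *.
have OO : F^T *m F + E^T *m E = 1%:M.
  rewrite -mul_row_col; apply: mulmx1C.
  have EF : E *m F^T = 0 by rewrite -[LHS]trmxK trmx_mul trmxK FE trmx0.
  by rewrite mul_col_row FF FE EE EF -scalar_mx_block.
have Fu P : Fib P -> op_dir P *m F^T \in unitmx.
  (* A direction of [P] without [F] component equals its [E] component, so it is also a direction of
     [T] and vanishes by transversality. *)
  move=> FP; rewrite -row_free_unit; apply: inj_row_free => u uPF.
  have [rf _ _ _] := fibF.
  apply/eqP; rewrite -(mulmx_free_eq0 _ (rf P FP)); apply/eqP.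
  apply: tr FP _ _ _; first exact: submxMl.
  rewrite -[u *m _]mulmx1 -OO mulmxDr mulmxA -(mulmxA u) uPF mul0mx add0r.
  by rewrite /E !mulmxA submxMl.
have [pos|neg] := fibre_det_sign Fu; first by exists F, G.
(* For [k = 0] there is no reflection, but the empty determinant is [1], so the negative case is
   impossible. *)
have k0 : (0 < k)%N.
  rewrite lt0n; apply/eqP => k0.
  have [c [cF _ _]] := fibre_choice; have := neg _ (cF 0).
  move: (op_dir (c 0) *m F^T); rewrite k0 => M.
  by rewrite det_mx00 ltr10.
have [J JJ dJ] := reflection R k0.
exists (J *m F), G; split=> //.
- by rewrite trmx_mul -mulmxA (mulmxA F) FF mul1mx.
- by rewrite -mulmxA FE mulmx0.
move=> P FP; rewrite trmx_mul mulmxA det_mulmx det_tr dJ mulrN1 oppr_gt0.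
exact: neg.
Qed.

End TransverseFibrations.

(** * The equivalence, and the normal form of a fibration in adapted coordinates *)

Theorem theorem3p15 (R : realType) (k q : nat) :
  (forall B : 'rV[R]_q -> 'M[R]_(k, q), continuous B ->
     (is_fibration ([set Py B y | y in [set: 'rV[R]_q]]) /\ skew_family ([set Py B y | y in [set: 'rV[R]_q]])) <->
     ((forall x y : 'rV[R]_q, x != y ->
         forall w : 'rV[R]_(k + 1), w *m (Amat B x - Amat B y) = 0 -> w = 0) /\
      (forall u : nat -> 'rV[R]_q, no_accum u ->
         forall M : R, \forall m \near \oo, M < dist0 B (u m))))
  /\
  (forall Fib : set (oplane R (k + q) k),
     is_fibration Fib -> skew_family Fib ->
     forall T : oplane R (k + q) q,
       row_free (op_dir T) -> transverse_all Fib T ->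
       exists (Q : 'M[R]_(k + q)) (c : 'rV[R]_(k + q)),
         [/\ Q *m Q^T = 1%:M,
             [set x *m Q + c | x in op_pts T] =
               [set row_mx 0 y | y in [set: 'rV[R]_q]] &
             exists B : 'rV[R]_q -> 'M[R]_(k, q),
               [/\ continuous B,
                   forall P, Fib P -> exists y, op_eq (op_img Q c P) (Py B y) &
                   forall y, exists2 P, Fib P & op_eq (op_img Q c P) (Py B y)]]).
Proof.
split=> [B Bc|Fib fibF _ T Tf tr].
  split=> [[fibB skewB]|[ker0 dinf]].
    split; first exact: fibration_distinct_ker.
    exact: fibration_dist.
  have bnd := dist_bounded dinf.
  by split; [exact: graph_fibration|exact: graph_skew].
have [F [G [Gu FF FE EE pos]]] := oriented_frame fibF Tf tr.
set E := G *m op_dir T in FE EE.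
(* [x *m Q] lists the coordinates of [x] in the orthonormal frame [F], [E], and [c] sends the base
   point of [T] to the origin. *)
pose Q := row_mx F^T E^T; pose c := - (op_pt T *m Q).
have EF : E *m F^T = 0 by rewrite -[LHS]trmxK trmx_mul trmxK FE trmx0.
have QE : Q^T = col_mx F E by rewrite /Q tr_row_mx !trmxK.
have QTQ : Q^T *m Q = 1%:M.
  by rewrite QE mul_col_row FF FE EE EF -scalar_mx_block.
have QQT : Q *m Q^T = 1%:M by exact: mulmx1C.
have lQ (P : oplane R (k + q) k) : lsubmx (op_dir P *m Q) = op_dir P *m F^T.
  by rewrite mul_mx_row row_mxKl.
have Qu P : Fib P -> lsubmx (op_dir P *m Q) \in unitmx.
  by move=> /pos; rewrite lQ unitmxE unitfE => h; rewrite gt_eqF.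
have [ch [chF chx chU]] := fibre_choice fibF.
(* [X y] is the point of [T] with new coordinates [(0, y)]; [B y] is the slope of the fiber through
   it. *)
pose X (y : 'rV[R]_q) : 'rV[R]_(k + q) := (row_mx 0 y - c) *m Q^T.
have XK y : X y *m Q + c = row_mx 0 y by rewrite /X -mulmxA QTQ mulmx1 subrK.
pose B y := slope (op_dir (ch (X y)) *m Q).
have graphP P y : Fib P -> op_pts P (X y) -> op_eq (op_img Q c P) (Py B y).
  move=> FP PX; apply: op_eq_graph.
  - by rewrite /= lQ pos.
  - rewrite /= /B; have [_ [H [H0 ->]]] := chU _ _ FP PX.
    by rewrite -mulmxA slopeM // ?Qu // unitmxE unitfE gt_eqF.
  - by rewrite -XK; exact: op_img_mem.
exists Q, c; split=> //.
  have TF : op_dir T *m F^T = 0.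
    by rewrite -[op_dir T](mulKmx Gu) -mulmxA EF mulmx0.
  have TE : op_dir T *m E^T = invmx G.
    by rewrite -{1}[op_dir T](mulKmx Gu) -mulmxA EE mulmx1.
  have TQ t : (op_pt T + t *m op_dir T) *m Q + c = row_mx 0 (t *m invmx G).
    rewrite mulmxDl addrAC subrr add0r -mulmxA /Q mul_mx_row TF TE.
    by rewrite mul_mx_row mulmx0.
  apply/seteqP; split=> [_ [_ [t ->] <-]|_ [y _ <-]].
    by exists (t *m invmx G) => //; rewrite TQ.
  exists (op_pt T + (y *m G) *m op_dir T); first by exists (y *m G).
  by rewrite TQ mulmxK.
exists B; split.
- move=> y.
  have Xc : X z @[z --> nbhs y] --> X y.
    apply: cvg_mulmx; last exact: cvg_cst.
    apply: cvgB; last exact: cvg_cst.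
    exact: (cvg_row_mx (cvg_cst _) (@cvg_refl _ (nbhs y))).
  exact: (cvg_comp X _ Xc (fibre_slope_continuous fibF chU Qu (x := X y))).
(* The index of a fiber is the point where its image meets [{0} x R^q]. *)
- move=> P FP; exists (foot (op_pt P *m Q + c) (op_dir P *m Q)).
  apply: graphP => //.
  have [t tE] := op_pts_foot (P := op_img Q c P) (Qu P FP).
  exists t; rewrite /X tE /= addrAC addrK.
  by rewrite mulmxA -mulmxDl -mulmxA QQT mulmx1.
- by move=> y; exists (ch (X y)) => //; exact: graphP.
Qed.
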